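(* Let $\mathcal V$ be a family of stencils, and let $u\in\mathbb U$. If $\overline{\mathcal D}_{\mathcal V}u(x)>0$ for all $x\in X$, or $\mathcal D_{\overline{\mathcal V}}u(x)>0$ for all $x\in X$, then $\overline{\mathcal D}_{\mathcal V}u(x)=\mathcal D_{\overline{\mathcal V}}u(x)$ for all $x\in X$.
   Context: $\Omega\subset\mathbb R^2$ is a fixed convex open bounded set, $X:=\Omega\cap\mathbb Z^2$, and $\mathbb U$ is the set of all maps $u:X\cup\partial\Omega\to\mathbb R$. Second order differences: for $e\in\mathbb Z^2\setminus\{0\}$, $u\in\mathbb U$, $x\in X$, let $h^{\pm}:=1$ if $x\pm e\in\Omega$, and otherwise let $h^\pm$ be the unique element of $]0,1]$ with $x\pm h^\pm e\in\partial\Omega$; set $$\Delta_e u(x):=\frac{2}{h^++h^-}\left(\frac{u(x+h^+e)-u(x)}{h^+}+\frac{u(x-h^-e)-u(x)}{h^-}\right),\qquad \Delta_e^+u(x):=\max\{0,\Delta_e u(x)\}.$$ A superbase of $\mathbb Z^2$ is a triplet $(e,f,g)\in(\mathbb Z^2)^3$ with $e+f+g=0$ and $|\det(f,g)|=1$. For $a,b,c\ge0$, $h(a,b,c):=bc$ if $a\ge b+c$, and likewise permuting $a,b,c$; otherwise $h(a,b,c):=\frac12(ab+bc+ca)-\frac14(a^2+b^2+c^2)$. Decomposition: $e=f\oplus g$ means that $e=f+g$ with $f,g\in\mathbb Z^2$, $\det(f,g)=1$, $\langle f,g\rangle\ge0$. (Such a decomposition exists, and is then unique, exactly when $e=(a,b)\in\mathbb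 Z^2$ with $\gcd(a,b)=1$ and $ab\ne0$.) Graph $\mathbb T$: vertices $\{e\in\mathbb Z^2;\gcd(e)=1\}$ (gcd of the two coordinates); edges $e\to f\oplus e$ and $e\to e\oplus g$ for each $e=f\oplus g$. Any subset of $\mathbb T$ is regarded as a subgraph, with all edges of $\mathbb T$ having both endpoints in it. $V_8:=\{-1,0,1\}^2\setminus\{(0,0)\}$. For $x\in X$, $\mathcal V_\Omega(x):=\{e=f\oplus g;\ x\pm e,\,x\pm f,\,x\pm g\in\Omega\}$, where ''$x\pm e\in\Omega$'' means $x+e\in\Omega$ and $x-e\in\Omega$. A stencil is a finite subset of $\mathbb Z^2\setminus\{0\}$ symmetric with respect to the origin. A family of stencils $\mathcal V$ is the data, for each $x\in X$, of a stencil $\mathcal V(x)$ with $V_8\subset\mathcal V(x)\subset\mathbb T$ and such that: (Hierarchy) $V_8$ has an element in each connected component of $\mathcal V(x)$; (Reachability) $\mathcal V(x)$ contains each $e\in\mathbb T\setminus\mathcal V_\Omega(x)$ such that $x\pm e\in\Omega$. Given $\mathcal V$, set $\overline{\mathcal V}(x):=\mathcal V(x)\cup\mathcal V_\Omega(x)$; $\overline{\mathcal V}$ is again a family of stencils. For a family of stencils $\mathcal V$, $$\mathcal D_{\mathcal V}u(x):=\min\{h(\Delta^+_eu(x),\Delta^+_fu(x),\Delta^+_gu(x));\ (e,f,g)\in\mathcal V(x)^3\text{ a superbase of }\mathbb Z^2\}.$$ The hierarchical operator $\overline{\mathcal D}_{\mathcal V}u(x)$ is the final value of $\mathbb D$ in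 the following algorithm. Initialize a variable $f\leftarrow(1,0)$, a list $G\leftarrow[(0,1),(-1,0)]$, and $\mathbb D\leftarrow+\infty$. While $G$ is non-empty do: denote by $g$ the first element of $G$ and set $e:=f+g$; if $e\in\mathcal V(x)$, or [$e\in\mathcal V_\Omega(x)$ and $\Delta_eu(x)<\Delta_fu(x)+\Delta_gu(x)$], then prepend $e$ to $G$ and set $\mathbb D\leftarrow\min\{\mathbb D,\,h(\Delta_e^+u(x),\Delta_f^+u(x),\Delta_g^+u(x))\}$; else remove $g$ from $G$ and set $f\leftarrow g$. *)

(* Defs.v *)
From mathcomp Require Import all_boot all_order all_algebra.
From mathcomp Require Import all_classical all_reals all_analysis.
From Stdlib Require Import Relation_Operators.
Set Implicit Arguments.
Unset Strict Implicit.
Unset Printing Implicit Defensive.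
Import Order.TTheory GRing.Theory Num.Theory numFieldNormedType.Exports.
Local Open Scope classical_set_scope.
Local Open Scope ring_scope.

Notation Z2 := (int * int)%type.

Definition det2 (f g : Z2) : int := f.1 * g.2 - f.2 * g.1.

Definition dot2 (f g : Z2) : int := f.1 * g.1 + f.2 * g.2.

Definition superbase (e f g : Z2) : Prop :=
  e + f + g = 0 /\ `|det2 f g| = 1.

(* [decomp e f g] means [e = f (+) g]. *)
Definition decomp (e f g : Z2) : Prop :=
  [/\ e = f + g, det2 f g = 1 & 0 <= dot2 f g].

Definition T_vertex : set Z2 := [set e | gcdz e.1 e.2 = 1].

Definition T_edge (e e' : Z2) : Prop :=
  exists f g, decomp e f g /\ (decomp e' f e \/ decomp e' e g).

Definition V8 : set Z2 :=
  [set e | [/\ e != 0, e.1 \in [:: -1; 0; 1] & e.2 \in [:: -1; 0; 1]]].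

(* Edges of the subgraph of [T_edge] induced by [S]; its connected components
   are those of the underlying undirected graph. *)
Definition sub_edge (S : set Z2) (e e' : Z2) : Prop :=
  [/\ S e, S e' & T_edge e e'].

Definition same_component (S : set Z2) : Z2 -> Z2 -> Prop :=
  clos_refl_sym_trans Z2 (sub_edge S).

Definition stencil (S : set Z2) : Prop :=
  [/\ finite_set S, ~ S 0 & forall e, S e -> S (- e)].

(* [R^o] rather than [R], so that the product is a normed module over [R]. *)
Notation plane R := (R^o * R^o)%type.

Section Operators.
Variable R : realType.

Definition inj_plane (e : Z2) : plane R := (e.1%:~R, e.2%:~R).

Definition frontier (A : set (plane R)) : set (plane R) := closure A `\` A°.

Variable Omega : set (plane R).

Definition grid : set Z2 := [set x | Omega (inj_plane x)].

Definition both_in (x e : Z2) : Prop := grid (x + e) /\ grid (x - e).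

Definition V_Omega (x : Z2) : set Z2 :=
  [set e | exists f g,
     [/\ decomp e f g, both_in x e, both_in x f & both_in x g]].

Definition stencil_family (V : Z2 -> set Z2) : Prop :=
  forall x, grid x ->
    [/\ stencil (V x),
        V8 `<=` V x,
        V x `<=` T_vertex,
        forall e, V x e -> exists2 e', V8 e' & same_component (V x) e e' &
        forall e, T_vertex e -> ~ V_Omega x e -> both_in x e -> V x e].

Definition stencil_bar (V : Z2 -> set Z2) (x : Z2) : set Z2 :=
  V x `|` V_Omega x.

(* [h^+] is [step_length x e] and [h^-] is [step_length x (- e)]. *)
Definition step_length (x e : Z2) : R :=
  if (x + e) \in grid then 1 else
  xget 0 [set h : R | 0 < h <= 1 /\
                      frontier Omega (inj_plane x + h *: inj_plane e)].

(* Only the values of [u] on [grid] and on the frontier of [Omega] are ever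
   used, so a total [u] stands for a map defined on their union. *)
Variable u : plane R -> R.

Definition Delta (e x : Z2) : R :=
  let hp := step_length x e in
  let hm := step_length x (- e) in
  let p := inj_plane x in
  2 / (hp + hm) *
    ((u (p + hp *: inj_plane e) - u p) / hp +
     (u (p - hm *: inj_plane e) - u p) / hm).

Definition Delta_pos (e x : Z2) : R := Num.max 0 (Delta e x).

Definition hfun (a b c : R) : R :=
  if b + c <= a then b * c
  else if a + c <= b then a * c
  else if a + b <= c then a * b
  else 2^-1 * (a * b + b * c + c * a) - 4^-1 * (a ^+ 2 + b ^+ 2 + c ^+ 2).

Definition hDelta (e f g x : Z2) : R :=
  hfun (Delta_pos e x) (Delta_pos f x) (Delta_pos g x).

Definition superbases_in (S : set Z2) : set (Z2 * Z2 * Z2) :=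
  [set t | [/\ S t.1.1, S t.1.2, S t.2 & superbase t.1.1 t.1.2 t.2]].

(* A minimum over a finite non-empty set when [V] is a family of stencils and
   [x] a grid point. *)
Definition D_op (V : Z2 -> set Z2) (x : Z2) : \bar R :=
  \big[Order.min/+oo%E]_(t \in superbases_in (V x))
     (hDelta t.1.1 t.1.2 t.2 x)%:E.

Definition loop_state : Type := (Z2 * seq Z2 * \bar R)%type.

Definition loop_init : loop_state :=
  ((1, 0), [:: (0, 1); (-1, 0)], +oo%E).

(* One iteration of the loop; a state whose list is empty is final. *)
Definition loop_body (V : Z2 -> set Z2) (x : Z2) (s : loop_state) :
    loop_state :=
  let: (f, G, D) := s in
  if G is g :: G' then
    let e := f + g in
    if (e \in V x) ||
       (e \in V_Omega x) && (Delta e x < Delta f x + Delta g x)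
    then (f, e :: G, Order.min D (hDelta e f g x)%:E)
    else (g, G', D)
  else s.

(* The value of the third variable once the list has become empty.  The loop
   terminates for a family of stencils of a bounded domain; the default value
   of [xget] would otherwise be returned. *)
Definition D_hier (V : Z2 -> set Z2) (x : Z2) : \bar R :=
  xget 0%E [set D | exists n f, iter n (loop_body V x) loop_init = (f, [::], D)].

End Operators.

(* Main.v *)
Require Import Defs.
From mathcomp Require Import all_boot all_order all_algebra.
From mathcomp Require Import all_classical all_reals all_analysis.
From mathcomp Require Import zify ring lra.
From Stdlib Require Import Relation_Operators.
Import Order.TTheory GRing.Theory Num.Theory numFieldNormedType.Exports.
Local Open Scope classical_set_scope.
Local Open Scope ring_scope.

(** Up to signs and permutations a superbase is [(f + g, f, g)] with
    [det2 f g = 1] and [0 <= dot2 f g], because the three scalar products of a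
    superbase cannot all be negative.  Hence [D_op] on the enlarged stencils is
    a minimum over the nodes [e = f (+) g] of the Stern-Brocot tree with [e] in
    [stencil_bar], whereas [D_hier] is the minimum over the nodes that the loop
    reaches in the two upper quadrants ([le_Dbar], [le_Dhier]).  The loop only
    reaches nodes of the first kind, so what has to be shown is that a node
    which it cuts off cannot have a smaller value.

    At the first node [e = f (+) g] cut off along a branch, [e] is not in the
    stencil, so by hierarchy nothing below it is either; everything below that
    still counts therefore lies in [V_Omega], where all second differences are
    genuine three point differences, and the loop test says
    [Delta f + Delta g <= Delta e].  This inequality passes on to the child
    [f + e] as soon as [u] is convex along [f] at the two points [x +- e]:
    convexity on the segments from [x +- g] to [x +- (f + e)], whose midpoints
    are [x +- e], bounds [Delta (f + e)] below by [2 Delta e - Delta g]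
    ([Delta_superadditive_child]).  In this regime the value of the node is the
    product of the differences along [f] and [g], and that product grows
    downwards; at the top it is at least the value of the parent, which was
    visited, since [hfun] never exceeds a product of two of its arguments
    ([reached_or_pruned]).

    Convexity, in the form [0 < Delta e y] whenever [y +- e] are grid points, is
    what the positivity hypotheses provide.  If the minimum over all superbases
    is positive this is immediate, every such [e] being a member of some
    superbase.  If the hierarchical minimum is positive, one argues by induction
    on [|e|^2]: either the loop visits [e], or it cuts it off and then
    [Delta e] is at least the sum of two differences along shorter vectors. *)

(** * Integer vectors and the Stern-Brocot tree *)

Definition nsq (e : Z2) : int := dot2 e e.

(** A node of the Stern-Brocot tree is stored as the pair of summands of a
    direct sum [f (+) g] rather than as the vector [f + g]: its children are
    then [(f, f + g)] and [(f + g, g)]. *)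
Definition direct_pair (f g : Z2) : Prop := det2 f g = 1 /\ 0 <= dot2 f g.

Lemma decompE e f g : decomp e f g <-> e = f + g /\ direct_pair f g.
Proof. by split=> [[-> ? ?]|[-> [? ?]]]. Qed.

Lemma lagrange_identity f g :
  nsq f * nsq g = det2 f g ^+ 2 + dot2 f g ^+ 2.
Proof. by rewrite /nsq /det2 /dot2; ring. Qed.

Lemma nsqD f g : nsq (f + g) = nsq f + nsq g + dot2 f g *+ 2.
Proof. by rewrite /nsq /dot2 /=; ring. Qed.

Lemma nsq_ge0 e : 0 <= nsq e.
Proof. by rewrite /nsq /dot2 -!expr2 addr_ge0 ?sqr_ge0. Qed.

Lemma direct_pair_nsq_gt0 {f g} : direct_pair f g -> 0 < nsq f /\ 0 < nsq g.
Proof.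
move=> [d1 _]; have := lagrange_identity f g; rewrite d1.
have := nsq_ge0 f; have := nsq_ge0 g; have := sqr_ge0 (dot2 f g); nia.
Qed.

Lemma direct_pair_nsq_lt {f g} :
  direct_pair f g -> nsq f < nsq (f + g) /\ nsq g < nsq (f + g).
Proof.
move=> fg; have [? ?] := direct_pair_nsq_gt0 fg; case: fg => _ ?.
by rewrite nsqD; lia.
Qed.

Lemma direct_pair_childl {f g} : direct_pair f g -> direct_pair f (f + g).
Proof.
have := nsq_ge0 f; rewrite /direct_pair /nsq /det2 /dot2 /= => ? [? ?].
by split; nia.
Qed.

Lemma direct_pair_childr {f g} : direct_pair f g -> direct_pair (f + g) g.
Proof.
have := nsq_ge0 g; rewrite /direct_pair /nsq /det2 /dot2 /= => ? [? ?].
by split; nia.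
Qed.

Lemma direct_pairN {f g} : direct_pair f g -> direct_pair (- f) (- g).
Proof.
by rewrite /direct_pair /det2 /dot2 /= !mulNr !mulrN !opprK.
Qed.

Lemma unit_vector e : nsq e = 1 ->
  [\/ e = (1, 0), e = (0, 1), e = (-1, 0) | e = (0, -1)].
Proof.
case: e => a b; rewrite /nsq /dot2 /= => h.
have h1 : a = 0 /\ (b = 1 \/ b = -1) \/ b = 0 /\ (a = 1 \/ a = -1) by nia.
by case: h1 => [[-> [->|->]]|[-> [->|->]]];
  [apply: Or42|apply: Or44|apply: Or41|apply: Or43].
Qed.

Lemma unit_direct_pair f g : nsq f = 1 -> nsq g = 1 -> direct_pair f g ->
  [\/ (f, g) = ((1, 0), (0, 1)), (f, g) = ((0, 1), (-1, 0)),
      (f, g) = (- (1, 0), - (0, 1)) | (f, g) = (- (0, 1), - (-1, 0))].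
Proof.
by move=> /unit_vector[]-> /unit_vector[]-> [] //= _ _;
  [apply: Or41|apply: Or42|apply: Or43|apply: Or44].
Qed.

Lemma direct_pair_subl {f g} :
  direct_pair f g -> direct_pair f (g - f) <-> nsq f <= dot2 f g.
Proof.
rewrite /direct_pair /nsq /det2 /dot2 /= => -[? ?].
by split=> [[]|?]; [|split]; nia.
Qed.

Lemma direct_pair_subr {f g} :
  direct_pair f g -> direct_pair (f - g) g <-> nsq g <= dot2 f g.
Proof.
rewrite /direct_pair /nsq /det2 /dot2 /= => -[? ?].
by split=> [[]|?]; [|split]; nia.
Qed.

(** If the scalar product [d] were smaller than both [|f|^2] and [|g|^2], then
    [(d + 1)^2 <= |f|^2 |g|^2 = d^2 + 1] would force [d = 0]; hence [f] can be
    subtracted from [g], or [g] from [f], unless both are axis vectors. *)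
Lemma direct_pair_parent {f g} : direct_pair f g ->
  [\/ nsq f = 1 /\ nsq g = 1, direct_pair f (g - f) | direct_pair (f - g) g].
Proof.
move=> fg; have [f0 g0] := direct_pair_nsq_gt0 fg.
have [_ subl] := direct_pair_subl fg; have [_ subr] := direct_pair_subr fg.
have [/subl|ltf] := leP (nsq f) (dot2 f g); first exact: Or32.
have [/subr|ltg] := leP (nsq g) (dot2 f g); first exact: Or33.
have := lagrange_identity f g; case: fg => -> d0 E.
have d00 : dot2 f g = 0 by nia.
rewrite d00 in E.
by apply: Or31; nia.
Qed.

(** Otherwise [|f|^2 |g|^2 <= d^2], against Lagrange's identity. *)
Lemma direct_pair_parent_unique {f g} :
  direct_pair f g -> direct_pair f (g - f) -> direct_pair (f - g) g -> False.
Proof.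
move=> fg /(direct_pair_subl fg) lef /(direct_pair_subr fg) leg.
have [f0 g0] := direct_pair_nsq_gt0 fg.
by have := lagrange_identity f g; case: fg => -> d0; nia.
Qed.

Lemma stern_brocot_ind (Q : Z2 -> Z2 -> Prop) :
  (forall f g, direct_pair f g -> nsq f = 1 -> nsq g = 1 -> Q f g) ->
  (forall f g, direct_pair f g -> Q f g -> Q f (f + g)) ->
  (forall f g, direct_pair f g -> Q f g -> Q (f + g) g) ->
  forall f g, direct_pair f g -> Q f g.
Proof.
move=> Q1 Ql Qr f g fg; have [n] := ubnP (absz (nsq (f + g))).
elim: n => // n IH in f g fg *; rewrite ltnS => le_n.
have [? ?] := direct_pair_nsq_lt fg.
have ? := nsq_ge0 f; have ? := nsq_ge0 g.
have [[? ?]|fg'|fg'] := direct_pair_parent fg; first exact: Q1.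
- have /(Ql _ _ fg') : Q f (g - f) by apply: IH => //; rewrite subrKC; lia.
  by rewrite subrKC.
- have /(Qr _ _ fg') : Q (f - g) g by apply: IH => //; rewrite subrK; lia.
  by rewrite subrK.
Qed.

(** Any other pair of determinant 1 with the same sum is [f + k (f + g)],
    [g - k (f + g)] for an integer [k], and its scalar product is negative
    unless [k = 0]. *)
Lemma decomp_unique {f g f' g'} : direct_pair f g -> direct_pair f' g' ->
  f + g = f' + g' -> f = f' /\ g = g'.
Proof.
move=> fg [D' d'] E; have [D d] := fg; have [f0 g0] := direct_pair_nsq_gt0 fg.
pose k := det2 f f'.
have g'E : g' = f + g - f' by rewrite E addrC addKr.
have Dk : det2 f' g = 1 + k.
  by move: D'; rewrite g'E /k /det2 /=; lia.
have basis (c c1 c2 : int) :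
    c * det2 f g = det2 f' g * c1 + k * c2 -> c = c1 + k * (c1 + c2).
  by rewrite D Dk; lia.
have f'E : f' = (f.1 + k * (f + g).1, f.2 + k * (f + g).2).
  rewrite {1}[f']surjective_pairing.
  by congr (_, _); apply: basis; rewrite /k /det2; ring.
have k0 : k = 0.
  move: d'; rewrite g'E f'E.
  have -> : dot2 (f.1 + k * (f + g).1, f.2 + k * (f + g).2)
     (f + g - (f.1 + k * (f + g).1, f.2 + k * (f + g).2)) =
    - (k * (k + 1)) * nsq f - k * (k - 1) * nsq g + (1 - 2 * k ^+ 2) * dot2 f g.
    by rewrite /nsq /dot2 /=; ring.
  move: (nsq f) (nsq g) (dot2 f g) f0 g0 d => F G d F0 G0 d0 d'.
  have [k1|k1|//] := ltgtP k 0.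
  - have : 0 <= k * (k + 1) * F by rewrite mulr_ge0 ?ltW//; nia.
    have : 0 < k * (k - 1) * G by rewrite mulr_gt0//; nia.
    have : 0 <= (2 * k ^+ 2 - 1) * d by rewrite mulr_ge0//; nia.
    lia.
  - have : 0 < k * (k + 1) * F by rewrite mulr_gt0//; nia.
    have : 0 <= k * (k - 1) * G by rewrite mulr_ge0 ?ltW//; nia.
    have : 0 <= (2 * k ^+ 2 - 1) * d by rewrite mulr_ge0//; nia.
    lia.
have ff' : f = f' by rewrite f'E k0 !mul0r !addr0; case: (f).
by split=> //; rewrite g'E -ff' addrC addKr.
Qed.

Lemma det_T_vertex {f g} : det2 f g = 1 -> T_vertex f /\ T_vertex g.
Proof.
rewrite /det2 /T_vertex /= => D.
have gcd1 (a b : int) : (gcdz a b %| 1%R)%Z -> gcdz a b = 1.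
  by rewrite dvdz1 /gcdz /= => /eqP ->.
split; apply: gcd1; rewrite -D; apply: rpredB.
- by rewrite dvdz_mulr ?dvdz_gcdl.
- by rewrite dvdz_mulr ?dvdz_gcdr.
- by rewrite dvdz_mull ?dvdz_gcdr.
- by rewrite dvdz_mull ?dvdz_gcdl.
Qed.

(** Bezout coefficients complete [e] to a basis of determinant 1, and adding a
    multiple of [e] to the second vector makes the pair a direct one; the
    descent then exhibits [e] itself as a sum. *)
Lemma T_vertexP e : T_vertex e ->
  nsq e = 1 \/ exists f g, direct_pair f g /\ e = f + g.
Proof.
rewrite /T_vertex /= => e1.
have [u [v uv]] := Bezoutz e.1 e.2; rewrite e1 in uv.
pose g : Z2 :=
  (- v + e.1 * `|dot2 e (- v, u)|, u + e.2 * `|dot2 e (- v, u)|).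
have eg : direct_pair e g.
  have e0 : 0 < nsq e by rewrite /nsq /dot2; nia.
  have D : det2 e g = 1 by rewrite -uv /g /det2 /=; ring.
  split=> //.
  have -> : dot2 e g = dot2 e (- v, u) + nsq e * `|dot2 e (- v, u)|.
    by rewrite /g /nsq /dot2 /=; ring.
  nia.
have [] // : (nsq e = 1 \/ exists f g, direct_pair f g /\ e = f + g) /\
  (nsq g = 1 \/ exists f g', direct_pair f g' /\ g = f + g').
move: eg; apply: (stern_brocot_ind (fun e g : Z2 =>
  (nsq e = 1 \/ exists p q, direct_pair p q /\ e = p + q) /\
  (nsq g = 1 \/ exists p q, direct_pair p q /\ g = p + q))).
- by move=> p q _ -> ->; split; left.
- by move=> p q pq [? _]; split=> //; right; exists p, q.
- by move=> p q pq [_ ?]; split=> //; right; exists p, q.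
Qed.

(** * The hierarchy of a stencil *)

Lemma T_edge_childl {f g} : direct_pair f g -> T_edge (f + g) (f + (f + g)).
Proof.
move=> fg; exists f, g; split; first exact/decompE.
by left; apply/decompE; split=> //; exact: direct_pair_childl.
Qed.

Lemma T_edge_childr {f g} : direct_pair f g -> T_edge (f + g) (f + g + g).
Proof.
move=> fg; exists f, g; split; first exact/decompE.
by right; apply/decompE; split=> //; exact: direct_pair_childr.
Qed.

Lemma T_edge_nsq {a b} : T_edge a b -> nsq a < nsq b.
Proof.
by move=> [f [g [_ []/decompE[-> /direct_pair_nsq_lt[]]]]].
Qed.

(** The child determines its summands, and the parent is one of them: the
    longer one, since it must be possible to subtract the other one from it. *)
Lemma T_edge_parent_unique {a a' b} : T_edge a b -> T_edge a' b -> a = a'.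
Proof.
have crossed p p' f g f' g' : direct_pair f g -> p = f + g ->
    direct_pair f' g' -> p' = f' + g' ->
    decomp b f p -> decomp b p' g' -> False.
  move=> fg pE fg' pE' /decompE[bE fp] /decompE[bE' pg'].
  have [Ef Ep] := decomp_unique fp pg' (etrans (esym bE) bE').
  apply: (direct_pair_parent_unique fp); first by rewrite pE addrC addKr.
  by rewrite Ef pE' Ep addrK.
move=> [f [g [/decompE[aE fg] ab]]] [f' [g' [/decompE[aE' fg'] ab']]].
case: ab ab' => ab [] ab'.
- by have [/decompE[E p] /decompE[E' p']] := (ab, ab');
    have [] := decomp_unique p p' (etrans (esym E) E').
- by case: (crossed a a' f g f' g').
- by case: (crossed a' a f' g' f g).
- by have [/decompE[E p] /decompE[E' p']] := (ab, ab');
    have [] := decomp_unique p p' (etrans (esym E) E').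
Qed.

Notation descendant := (clos_refl_trans_n1 Z2 T_edge).

Lemma descendant_nsq {e d} : descendant e d -> nsq e <= nsq d.
Proof. by elim=> // a b /T_edge_nsq ab _; lia. Qed.

(** A path in [S] leaves the descendants of [e] only through the edge from [e]
    to its parent, which is unavailable when the parent is not in [S]. *)
Lemma descendant_component {S : set Z2} {a e p q} : T_edge a e -> ~ S a ->
  same_component S p q -> descendant e p <-> descendant e q.
Proof.
move=> ae Sa; elim=> {p q} [p q [Sp _ pq]|//|p q _ [? ?]|p q r _ [? ?] _ [? ?]];
  [|by split; auto..].
split=> [ep|edq]; first exact: rtn1_trans pq ep.
case: edq pq Sp => [pe|b c bc eb pc _].
  by rewrite -(T_edge_parent_unique ae pe).
by rewrite (T_edge_parent_unique pc bc).
Qed.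

Lemma V8_nsq {e} : V8 e -> nsq e <= 2.
Proof.
case: e => a b [_ /=]; rewrite /nsq /dot2 /= !inE.
by move=> /or3P[]/eqP-> /or3P[]/eqP->.
Qed.

(** What the hierarchy axiom is used for: the component of [e] reaches [V8],
    whose elements are too short to be descendants of [e]. *)
Lemma component_parent {S : set Z2} {a e e'} : T_edge a e -> 2 < nsq e ->
  V8 e' -> same_component S e e' -> S a.
Proof.
move=> ae e2 /V8_nsq e'2 ee'; apply: contrapT => Sa.
have [/(_ (rtn1_refl _ _ _))/descendant_nsq + _] :=
  descendant_component ae Sa ee'.
lia.
Qed.

Section Stencils.
Context {R : realType} {Omega : set (plane R)}.

Lemma both_inN {x e} : both_in Omega x e -> both_in Omega x (- e).
Proof. by case=> ? ?; split; rewrite ?opprK. Qed.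

Lemma V_OmegaE {x f g} : direct_pair f g ->
  V_Omega Omega x (f + g) <->
  [/\ both_in Omega x (f + g), both_in Omega x f & both_in Omega x g].
Proof.
move=> fg; split=> [[f' [g' [/decompE[E fg'] ? ? ?]]]|[? ? ?]].
  by have [-> ->] := decomp_unique fg fg' E; rewrite -E.
by exists f, g; split=> //; exact/decompE.
Qed.

Lemma V_OmegaN {x e} : V_Omega Omega x e -> V_Omega Omega x (- e).
Proof.
move=> [f [g [/decompE[-> fg] ? ? ?]]]; exists (- f), (- g).
split; try exact: both_inN.
by apply/decompE; split; [rewrite opprD|exact: direct_pairN].
Qed.

Lemma unit_V8 {e} : nsq e = 1 -> V8 e.
Proof. by move=> /unit_vector[]->. Qed.

Context {V : Z2 -> set Z2} (V_family : stencil_family Omega V).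
Context {x : Z2} (gx : grid Omega x).

Local Notation Vbar := (stencil_bar Omega V x).

Lemma V_N {e} : V x e -> V x (- e).
Proof. by have [[_ _ VN] _ _ _ _] := V_family x gx; exact: VN. Qed.

Lemma VbarN {e} : Vbar e -> Vbar (- e).
Proof. by move=> [/V_N|/V_OmegaN]; [left|right]. Qed.

Lemma V_unit {e} : nsq e = 1 -> V x e.
Proof. by have [_ V8V _ _ _] := V_family x gx; move/unit_V8/V8V. Qed.

(** Reachability makes membership in the enlarged stencil follow from
    [x +- e] being grid points alone. *)
Lemma both_in_Vbar {e} : T_vertex e -> both_in Omega x e -> Vbar e.
Proof.
have [_ _ _ _ reach] := V_family x gx; move=> Te xe.
have [eV|eV] := pselect (V_Omega Omega x e); first by right.
by left; exact: reach.
Qed.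

Lemma V_parent {a e} : T_edge a e -> 2 < nsq e -> V x e -> V x a.
Proof.
have [_ _ _ hier _] := V_family x gx; move=> ae e2 /hier[e' V8e' ee'].
exact: component_parent ae e2 V8e' ee'.
Qed.

Lemma child_nsq_gt2 {f g} : direct_pair f g ->
  2 < nsq (f + (f + g)) /\ 2 < nsq (f + g + g).
Proof.
move=> fg; have [f0 g0] := direct_pair_nsq_gt0 fg.
have [_ dl] := direct_pair_childl fg; have [_ dr] := direct_pair_childr fg.
have := nsqD f g; have := nsqD f (f + g); have := nsqD (f + g) g.
by case: fg => _; lia.
Qed.

Lemma V_parentl {f g} : direct_pair f g -> V x (f + (f + g)) -> V x (f + g).
Proof.
by move=> fg; apply: V_parent (T_edge_childl fg) _; have [] := child_nsq_gt2 fg.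
Qed.

Lemma V_parentr {f g} : direct_pair f g -> V x (f + g + g) -> V x (f + g).
Proof.
by move=> fg; apply: V_parent (T_edge_childr fg) _; have [] := child_nsq_gt2 fg.
Qed.

(** One summand is the parent, the other one is a summand of the parent. *)
Lemma V_summands {f g} : direct_pair f g -> V x (f + g) -> V x f /\ V x g.
Proof.
apply: (stern_brocot_ind (fun f g => V x (f + g) -> V x f /\ V x g)).
- by move=> p q _ p1 q1 _; split; exact: V_unit.
- by move=> p q pq IH /(V_parentl pq) Vpq; have [] := IH Vpq.
- by move=> p q pq IH /(V_parentr pq) Vpq; have [] := IH Vpq.
Qed.

Lemma Vbar_summands {f g} : direct_pair f g -> Vbar (f + g) -> Vbar f /\ Vbar g.
Proof.
move=> fg [/(V_summands fg)[]|/(V_OmegaE fg)[_ xf xg]]; first by split; left.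
have [Tf Tg] := det_T_vertex fg.1.
by split; exact: both_in_Vbar.
Qed.

End Stencils.

(** * Second order differences *)

Section Differences.
Context {R : realType} {Omega : set (plane R)} {u : plane R -> R}.

Local Notation Delta := (Delta Omega u).
Local Notation w e := (u (inj_plane R e)).

Lemma DeltaN e x : Delta (- e) x = Delta e x.
Proof.
rewrite /Defs.Delta; cbv zeta; rewrite opprK [step_length _ _ (- e) + _]addrC.
congr (_ * _).
have -> : inj_plane R (- e) = - inj_plane R e.
  by rewrite /inj_plane /= !mulrNz.
by rewrite !scalerN opprK [LHS]addrC.
Qed.

Lemma Delta_both_in e x : both_in Omega x e ->
  Delta e x = w (x + e) + w (x - e) - 2 * w x.
Proof.
move=> [xe xNe].
rewrite /Defs.Delta; cbv zeta.
rewrite /step_length !ifT ?inE // !scale1r !divr1.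
have -> : inj_plane R x + inj_plane R e = inj_plane R (x + e).
  by rewrite /inj_plane /= !mulrzDr.
have -> : inj_plane R x - inj_plane R e = inj_plane R (x - e).
  by rewrite /inj_plane /= !mulrzBr.
by rewrite -mulr2n divff ?pnatr_eq0 // mul1r; ring.
Qed.

(** With [c = f + (f + g)], the midpoint of [x + g] and [x + c] is
    [x + (f + g)], and likewise on the other side of [x]; convexity along [f] at
    these two points gives [2 * Delta (f + g) <= Delta g + Delta c]. *)
Lemma Delta_superadditive_child {f g x} :
  both_in Omega x f -> both_in Omega x g -> both_in Omega x (f + g) ->
  both_in Omega x (f + (f + g)) ->
  (forall y, grid Omega y -> both_in Omega y f -> 0 <= Delta f y) ->
  Delta f x + Delta g x <= Delta (f + g) x ->
  Delta f x + Delta (f + g) x <= Delta (f + (f + g)) x.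
Proof.
move=> xf xg xe xc f_ge0.
have pE : x + (f + g) + f = x + (f + (f + g)).
  by rewrite -addrA [f + g + f]addrC.
have pE' : x + (f + g) - f = x + g by rewrite [f + g]addrC addrA addrK.
have mE : x - (f + g) + f = x - g by rewrite opprD addrA addrAC subrK.
have mE' : x - (f + g) - f = x - (f + (f + g)).
  by rewrite [f + (f + g)]addrC [in RHS]opprD addrA.
have [[? ?] [? ?]] := (xg, xc).
have xep : both_in Omega (x + (f + g)) f by rewrite /both_in pE pE'.
have xem : both_in Omega (x - (f + g)) f by rewrite /both_in mE mE'.
have := f_ge0 _ xe.1 xep; have := f_ge0 _ xe.2 xem.
rewrite !Delta_both_in // pE pE' mE mE'; lra.
Qed.

End Differences.

Section Hfun.
Context {R : realType}.
Implicit Types a b c : R.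

Lemma hfun_swap12 a b c : 0 <= a -> 0 <= b -> 0 <= c ->
  hfun a b c = hfun b a c.
Proof.
by rewrite /hfun => a0 b0 c0; repeat case: ifPn; rewrite -?ltNge; nra.
Qed.

Lemma hfun_swap23 a b c : 0 <= a -> 0 <= b -> 0 <= c ->
  hfun a b c = hfun a c b.
Proof.
by rewrite /hfun => a0 b0 c0; repeat case: ifPn; rewrite -?ltNge; nra.
Qed.

(** In its last case [hfun a b c] is [a * b - (a + b - c) ^ 2 / 4]. *)
Lemma hfun_le12 a b c : 0 <= a -> 0 <= b -> 0 <= c -> hfun a b c <= a * b.
Proof.
by rewrite /hfun => a0 b0 c0; repeat case: ifPn; rewrite -?ltNge; nra.
Qed.

Lemma hfun_le13 a b c : 0 <= a -> 0 <= b -> 0 <= c -> hfun a b c <= a * c.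
Proof. by move=> *; rewrite hfun_swap23 // hfun_le12. Qed.

Lemma hfun_superadditive a b c : b + c <= a -> hfun a b c = b * c.
Proof. by rewrite /hfun => ->. Qed.

End Hfun.

(** * The traversal loop *)

(** The nodes reached from [(f, g)] through nodes satisfying [A]. The path is
    read from its start, as in the recursion of the loop, while the descent
    that compares nodes with their parents extends it at its end: hence
    [walkE] on the one hand, [walk_snocl] and [walk_snocr] on the other. *)
Inductive walk (A : Z2 -> Z2 -> Prop) : Z2 -> Z2 -> Z2 -> Z2 -> Prop :=
| walk_here f g : A f g -> walk A f g f g
| walk_left f g p q : A f g -> walk A f (f + g) p q -> walk A f g p q
| walk_right f g p q : A f g -> walk A (f + g) g p q -> walk A f g p q.

Lemma walk_snocl {A f g p q} :
  walk A f g p q -> A p (p + q) -> walk A f g p (p + q).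
Proof.
elim=> {f g p q} [f g fg ?|f g p q fg _ IH /IH|f g p q fg _ IH /IH].
- by apply: walk_left => //; exact: walk_here.
- exact: walk_left.
- exact: walk_right.
Qed.

Lemma walk_snocr {A f g p q} :
  walk A f g p q -> A (p + q) q -> walk A f g (p + q) q.
Proof.
elim=> {f g p q} [f g fg ?|f g p q fg _ IH /IH|f g p q fg _ IH /IH].
- by apply: walk_right => //; exact: walk_here.
- exact: walk_left.
- exact: walk_right.
Qed.

Lemma walk_direct_pair {A f g p q} :
  walk A f g p q -> direct_pair f g -> direct_pair p q.
Proof.
by elim=> {f g p q} // f g p q _ _ + fg; apply;
  [exact: direct_pair_childl|exact: direct_pair_childr].
Qed.

Lemma walk_end {A f g p q} : walk A f g p q -> A p q.
Proof. by elim. Qed.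

Lemma walkE {A f g p q} : walk A f g p q <->
  A f g /\ [\/ p = f /\ q = g, walk A f (f + g) p q | walk A (f + g) g p q].
Proof.
split=> [|[Afg [[-> ->]|?|?]]]; last 3 first.
- exact: walk_here.
- exact: walk_left.
- exact: walk_right.
by case=> {f g p q} f g => [|p q|p q] *; split=> //;
  [exact: Or31|exact: Or32|exact: Or33].
Qed.

Section Traversal.
Context {R : realType} {Omega : set (plane R)} {u : plane R -> R}.
Context {V : Z2 -> set Z2} {x : Z2}.

Definition loop_accepts (f g : Z2) : Prop :=
  V x (f + g) \/ V_Omega Omega x (f + g) /\
    Delta Omega u (f + g) x < Delta Omega u f x + Delta Omega u g x.

Definition loop_visits (p q : Z2) : Prop :=
  walk loop_accepts (1, 0) (0, 1) p q \/ walk loop_accepts (0, 1) (-1, 0) p q.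

Definition loop_value (p q : Z2) : \bar R :=
  (hDelta Omega u (p + q) p q x)%:E.

Local Notation body := (loop_body Omega u V x).

Lemma loop_bodyE f g G D : body (f, g :: G, D) =
  if `[< loop_accepts f g >] then
    (f, f + g :: g :: G,
     Order.min D (loop_value f g))
  else (g, G, D).
Proof.
rewrite /loop_body; congr (if _ then _ else _).
apply/idP/asboolP => [/orP[/set_mem|/andP[/set_mem]]|[?|[? ?]]].
- by left.
- by right.
- by apply/orP; left; exact/mem_set.
- by apply/orP; right; apply/andP; split=> //; exact/mem_set.
Qed.

(** Processing one gap between consecutive directions [f] and [g] amounts to a
    depth first traversal of the subtree below [(f, g)]. The final value of the
    third variable is described by its lower bounds, which makes the order of
    the traversal irrelevant. Since accepted vectors are bounded and lengths
    increase downwards, [N - nsq (f + g)] bounds the depth. *)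
Lemma loop_walk (N : int) (n : nat) f g G D :
  (forall p q, loop_accepts p q -> nsq (p + q) <= N) ->
  direct_pair f g -> N < nsq (f + g) + n%:Z ->
  exists k D', iter k body (f, g :: G, D) = (g, G, D') /\
    forall z, (z <= D')%E <-> (z <= D)%E /\
      forall p q, walk loop_accepts f g p q ->
        (z <= loop_value p q)%E.
Proof.
move=> leN; elim: n => [|n IH] in f g G D * => fg ltN;
  have [acc|nacc] := pselect (loop_accepts f g).
- by have := leN _ _ acc; lia.
- exists 1%N, D; rewrite -[iter _ _ _]/(body _) loop_bodyE asboolF //.
  by split=> // z; split=> [zD|[]//]; split=> // p q /walkE[].
- set h := loop_value f g.
  have fl := direct_pair_childl fg; have fr := direct_pair_childr fg.
  have lt1 := (direct_pair_nsq_lt fl).2; have lt2 := (direct_pair_nsq_lt fr).1.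
  have [|k1 [D1 [E1 H1]]] :=
    IH _ _ (g :: G) (Order.min D (loop_value f g)) fl; first lia.
  have [|k2 [D2 [E2 H2]]] := IH _ _ G D1 fr; first lia.
  exists (k2 + (k1 + 1))%N, D2; split.
    rewrite !iterD -[iter 1 _ _]/(body _) loop_bodyE asboolT //.
    by rewrite E1 E2.
  move=> z; rewrite H2 H1 le_min; split=> [[[/andP[zD zh] Hl] Hr]|[zD Hw]].
    split; first exact: zD.
    move=> p q /walkE[_ [[-> ->]|w|w]]; [exact: zh|exact: Hl|exact: Hr].
  split=> [|p q w]; last by apply/Hw/walkE; split=> //; exact: Or33.
  split=> [|p q w]; last by apply/Hw/walkE; split=> //; exact: Or32.
  by rewrite zD; apply/Hw/walk_here.
- exists 1%N, D; rewrite -[iter _ _ _]/(body _) loop_bodyE asboolF //.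
  by split=> // z; split=> [zD|[]//]; split=> // p q /walkE[].
Qed.

Lemma loop_final f D n : iter n body (f, [::], D) = (f, [::], D).
Proof. by elim: n => //= n ->. Qed.

Lemma D_hierE n f D :
  iter n body (loop_init R) = (f, [::], D) -> D_hier Omega u V x = D.
Proof.
move=> E; apply: xget_unique; first by exists n, f.
move=> D' [n' [f' E']].
have [le_n|/ltnW le_n] := leqP n n'.
  by move: E'; rewrite -(subnK le_n) iterD E loop_final => -[].
by move: E; rewrite -(subnK le_n) iterD E' loop_final => -[].
Qed.

Lemma le_D_hier (N : int) :
  (forall p q, loop_accepts p q -> nsq (p + q) <= N) ->
  forall z, (z <= D_hier Omega u V x)%E <->
    forall p q, loop_visits p q -> (z <= loop_value p q)%E.
Proof.
move=> leN z.
have N1 e : N < nsq e + (absz N).+1%:Z by have := nsq_ge0 e; lia.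
have [k1 [D1 [E1 H1]]] := loop_walk N _ (1, 0) (0, 1) [:: (-1, 0)] +oo%E leN
  (conj erefl erefl) (N1 _).
have [k2 [D2 [E2 H2]]] := loop_walk N _ (0, 1) (-1, 0) [::] D1 leN
  (conj erefl erefl) (N1 _).
rewrite (D_hierE (k2 + k1) (-1, 0) D2) ?iterD; last by rewrite /loop_init E1 E2.
rewrite H2 H1 leey; split=> [[[_ ?] ?] p q []|H]; auto.
by split=> [|p q w]; [split=> // p q w|]; apply: H; [left|right].
Qed.

End Traversal.

Arguments loop_accepts {R} Omega u V x f g.
Arguments loop_visits {R} Omega u V x p q.
Arguments loop_value {R} Omega u x p q.

Section DirectMinimum.
Context {R : realType} {Omega : set (plane R)} {u : plane R -> R}.

Lemma le_D_op (W : Z2 -> set Z2) x z : finite_set (W x) ->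
  (z <= D_op Omega u W x)%E <->
  forall e f g, W x e -> W x f -> W x g -> superbase e f g ->
    (z <= (hDelta Omega u e f g x)%:E)%E.
Proof.
move=> finW.
have finS : finite_set (superbases_in (W x)).
  apply: (@sub_finite_set _ _ (W x `*` W x `*` W x)).
    by move=> [[e f] g] [].
  by do 2![apply: finite_setX => //].
have le_seq s : (z <= \big[Order.min/+oo%E]_(t <- s)
      (hDelta Omega u t.1.1 t.1.2 t.2 x)%:E)%E <->
    forall t, t \in s -> (z <= (hDelta Omega u t.1.1 t.1.2 t.2 x)%:E)%E.
  elim: s => [|t s IH]; first by rewrite big_nil leey.
  rewrite big_cons le_min; split=> [/andP[zt /IH zs] t'|H].
    by rewrite inE => /predU1P[->|/zs].
  rewrite H ?mem_head //=; apply/IH => t' ts; apply: H.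
  by rewrite inE ts orbT.
rewrite /D_op le_seq; split=> [H e f g We Wf Wg efg|H [[e f] g]].
  (* Values of [hDelta] are finite, so every superbase is in the support. *)
  apply: (H (e, f, g)); rewrite in_finite_support; last exact: finite_setIl.
  by rewrite inE.
rewrite in_finite_support; last exact: finite_setIl.
by rewrite inE => -[[? ? ? ?] _]; exact: H.
Qed.

End DirectMinimum.

(** * Finiteness and superbases *)

Lemma finite_int_ball (a K : int) : finite_set [set b : int | `|a + b| <= K].
Proof.
apply/(@sub_finite_set _ _
  [set` [seq i%:Z - K - a | i <- iota 0 (2 * absz K).+1]]).
  move=> b Hb; rewrite /= in Hb.
  apply/mapP; exists (absz (a + b + K)); last lia.
  by rewrite mem_iota; lia.
exact: finite_seq.
Qed.

Lemma finite_nsq_bound {W : set Z2} : finite_set W ->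
  exists N, forall e, W e -> nsq e <= N.
Proof.
move=> /finite_seqP[s ->]; elim: s => [|e s [N IH]]; first by exists 0.
exists (Num.max (nsq e) N) => e' /=; rewrite inE le_max.
by move=> /predU1P[->|/IH ->]; rewrite ?lexx ?orbT.
Qed.

(** Let [F], [G], [d] be [|f|^2], [|g|^2] and the scalar product of [f] and [g].
    If all three scalar products were negative, then [- d], [F + d] and [G + d]
    would be positive integers; but the sum of their pairwise products is
    [F G - d^2 = 1]. *)
Lemma superbase_dot {e f g} : superbase e f g ->
  [\/ 0 <= dot2 f g, 0 <= dot2 e g | 0 <= dot2 e f].
Proof.
move=> [efg D].
have eE : e = - (f + g) by apply/eqP; rewrite -addr_eq0 addrA efg.
have [|fg] := leP 0 (dot2 f g); first by move=> _; exact: Or31.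
have [|eg] := leP 0 (dot2 e g); first by move=> _; exact: Or32.
have [|ef] := leP 0 (dot2 e f); first by move=> _; exact: Or33.
exfalso; have D2 : det2 f g ^+ 2 = 1.
  by have [->|->] : det2 f g = 1 \/ det2 f g = -1 by lia.
have := lagrange_identity f g; rewrite D2.
have egE : dot2 e g = - dot2 f g - nsq g by rewrite eE /nsq /dot2 /=; ring.
have efE : dot2 e f = - dot2 f g - nsq f by rewrite eE /nsq /dot2 /=; ring.
move: egE efE fg eg ef; move: (nsq f) (nsq g) (dot2 f g) => F G d -> -> *.
have : (- d) * (F + d) > 0 by rewrite mulr_gt0; lia.
have : (- d) * (G + d) > 0 by rewrite mulr_gt0; lia.
have : (F + d) * (G + d) > 0 by rewrite mulr_gt0; lia.
nia.
Qed.

Section Boundedness.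
Context {R : realType} {Omega : set (plane R)}.
Context (Omega_bounded : bounded_set Omega).

Lemma finite_both_in x : finite_set [set e | both_in Omega x e].
Proof.
have [M [_ HM]] := Omega_bounded.
have {}HM p : Omega p -> `|p| <= `|M| + 1.
  move=> Op; apply: (HM (`|M| + 1)) => //.
  by rewrite (le_lt_trans (ler_norm M)) ?ltrDl.
pose K : int := (Num.bound (`|M| + 1))%:Z.
have leK (z : int) : `|z%:~R : R| <= `|M| + 1 -> `|z| <= K.
  move=> zM; rewrite -(ler_int R) intr_norm (le_trans zM) // ltW //.
  by rewrite archi_boundP // addr_ge0.
apply: (@sub_finite_set _ _ ([set b | `|x.1 + b| <= K] `*`
  [set b | `|x.2 + b| <= K])); last first.
  by apply: finite_setX; exact: finite_int_ball.
move=> e [/HM + _]; rewrite prod_normE ge_max => /andP[? ?].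
by split; apply: leK.
Qed.

End Boundedness.

(** * Comparison of the two operators *)

Section Comparison.
Context {R : realType} {Omega : set (plane R)} {u : plane R -> R}.
Context {V : Z2 -> set Z2} (V_family : stencil_family Omega V).
Context (Omega_bounded : bounded_set Omega).

Local Notation Delta := (Delta Omega u).
Local Notation Delta_pos := (Delta_pos Omega u).
Local Notation hDelta := (hDelta Omega u).
Local Notation Vbar := (stencil_bar Omega V).
Local Notation accepted := (loop_accepts Omega u V).
Local Notation visited := (loop_visits Omega u V).
Local Notation node_value := (loop_value Omega u).
Local Notation Dhier := (D_hier Omega u V).
Local Notation Dbar := (D_op Omega u Vbar).

Lemma Delta_pos_ge0 e x : 0 <= Delta_pos e x.
Proof. by rewrite /Defs.Delta_pos le_max lexx. Qed.

Lemma Delta_pos_id e x : 0 <= Delta e x -> Delta_pos e x = Delta e x.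
Proof. by move=> ?; rewrite /Defs.Delta_pos max_r. Qed.

Lemma Delta_posN e x : Delta_pos (- e) x = Delta_pos e x.
Proof. by rewrite /Defs.Delta_pos DeltaN. Qed.

Lemma hDelta_swap12 e f g x : hDelta e f g x = hDelta f e g x.
Proof. by apply: hfun_swap12; exact: Delta_pos_ge0. Qed.

Lemma hDelta_swap23 e f g x : hDelta e f g x = hDelta e g f x.
Proof. by apply: hfun_swap23; exact: Delta_pos_ge0. Qed.

(** Every product of two arguments dominates [hfun], so none of them
    vanishes. *)
Lemma hDelta_gt0 {e f g x} : 0 < hDelta e f g x ->
  [/\ 0 < Delta e x, 0 < Delta f x & 0 < Delta g x].
Proof.
have pos e' : 0 < Delta_pos e' x -> 0 < Delta e' x.
  by rewrite /Defs.Delta_pos lt_max ltxx.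
have h12 e' f' g' : hDelta e' f' g' x <= Delta_pos e' x * Delta_pos f' x.
  by apply: hfun_le12; exact: Delta_pos_ge0.
have h_first e' f' g' : 0 < hDelta e' f' g' x -> 0 < Delta e' x.
  move=> h0; apply: pos; have lt0 := lt_le_trans h0 (h12 e' f' g').
  rewrite lt0r Delta_pos_ge0 andbT; apply: contraTneq lt0 => ->.
  by rewrite mul0r ltxx.
move=> h0; split; first exact: h_first h0.
  by apply: (h_first _ e g); rewrite hDelta_swap12.
by apply: (h_first _ e f); rewrite hDelta_swap12 hDelta_swap23.
Qed.

Lemma node_valueN f g x : node_value x (- f) (- g) = node_value x f g.
Proof. by rewrite /loop_value -opprD /Defs.hDelta !Delta_posN. Qed.

Section AtPoint.
Context {x : Z2} (gx : grid Omega x).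

Lemma finite_Vbar : finite_set (Vbar x).
Proof.
have [[finV _ _] _ _ _ _] := V_family x gx.
rewrite /stencil_bar finite_setU; split; first exact: finV.
apply: sub_finite_set (finite_both_in Omega_bounded x).
by move=> e [f [g []]].
Qed.

Lemma accepted_Vbar {f g} : accepted x f g -> Vbar x (f + g).
Proof. by case=> [|[]]; [left|right]. Qed.

Lemma acceptedN {f g} : accepted x f g -> accepted x (- f) (- g).
Proof.
rewrite /loop_accepts -opprD !DeltaN.
case=> [Ve|[Ve ?]]; first by left; exact: (V_N V_family gx Ve).
by right; split=> //; exact: V_OmegaN.
Qed.

Lemma visited_node {f g} : visited x f g -> direct_pair f g /\ Vbar x (f + g).
Proof.
by case=> w; split;
  [exact: walk_direct_pair w _|exact: accepted_Vbar (walk_end w)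
  |exact: walk_direct_pair w _|exact: accepted_Vbar (walk_end w)].
Qed.

Lemma le_Dhier z : (z <= Dhier x)%E <->
  forall p q, visited x p q -> (z <= node_value x p q)%E.
Proof.
have [N leN] := finite_nsq_bound finite_Vbar.
by apply: (le_D_hier N) => p q /accepted_Vbar/leN.
Qed.

(** Negating the vectors of a superbase and permuting them leaves [hDelta]
    unchanged and puts the superbase in the form [(f + g, f, g)]. *)
Lemma le_Dbar z : (z <= Dbar x)%E <->
  forall f g, direct_pair f g -> Vbar x (f + g) -> (z <= node_value x f g)%E.
Proof.
rewrite (le_D_op _ _ _ finite_Vbar); split=> [H f g fg Ve|H e f g Ve Vf Vg efg].
  have [Vf Vg] := Vbar_summands V_family gx fg Ve.
  have := H (- (f + g)) f g (VbarN V_family gx Ve) Vf Vg.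
  rewrite /loop_value /Defs.hDelta Delta_posN; apply; split.
    by rewrite -addrA addNr.
  by rewrite fg.1.
have core e' f' g' : Vbar x e' -> superbase e' f' g' -> 0 <= dot2 f' g' ->
    (z <= (hDelta e' f' g' x)%:E)%E.
  move=> Ve' [s0 D] d0.
  have eE : - e' = f' + g'.
    by apply/eqP; rewrite eq_sym -addr_eq0 addrC addrA s0.
  have := VbarN V_family gx Ve'; rewrite eE => VNe.
  have [D1|D1] : det2 f' g' = 1 \/ det2 g' f' = 1.
    by move: D; rewrite /det2; lia.
  - have := H f' g' (conj D1 d0) VNe.
    by rewrite /loop_value /Defs.hDelta -eE Delta_posN.
  - have := H g' f' (conj D1 _); rewrite [g' + f']addrC.
    rewrite /loop_value [g' + f']addrC hDelta_swap23 /Defs.hDelta -eE.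
    rewrite Delta_posN.
    by apply; [rewrite /dot2 mulrC [g'.2 * _]mulrC|rewrite eE].
have [s0 D] := efg.
have eE : e = - (f + g) by apply/eqP; rewrite -addr_eq0 addrA s0.
have [d|d|d] := superbase_dot efg.
- exact: core.
- rewrite hDelta_swap12; apply: core => //; split.
    by rewrite [f + e]addrC.
  by move: D; rewrite eE /det2 /=; lia.
- rewrite hDelta_swap23 hDelta_swap12; apply: core => //; split.
    by rewrite -addrA addrC.
  by move: D; rewrite eE /det2 /=; lia.
Qed.

Lemma unit_visited :
  visited x (1, 0) (0, 1) /\ visited x (0, 1) (-1, 0).
Proof.
by have [_ V8V _ _ _] := V_family x gx; split; [left|right]; apply: walk_here;
  left; apply: V8V.
Qed.

(** The convexity available when vectors of squared length [n] are treated; the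
    bound is what allows it to be established by induction on the length. *)
Definition convex_below (n : int) : Prop := forall e y,
  T_vertex e -> nsq e < n -> grid Omega y -> both_in Omega y e ->
  0 < Delta e y.

(** The state of a node of the enlarged stencil from the first one that the
    loop cuts off downwards; it is inherited from parent to child. *)
Definition pruned (f g : Z2) : Prop :=
  [/\ [/\ both_in Omega x (f + g), both_in Omega x f & both_in Omega x g],
      ~ V x (f + g), Delta f x + Delta g x <= Delta (f + g) x &
      (Dhier x <= (Delta f x * Delta g x)%:E)%E].

(** The loop visits the upper half plane only, and nodes count up to sign. *)
Definition reached (f g : Z2) : Prop :=
  visited x f g \/ visited x (- f) (- g).

Lemma prunedC {f g} : pruned f g -> pruned g f.
Proof.
rewrite /pruned [g + f]addrC [Delta g x + _]addrC [Delta g x * _]mulrC.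
case=> -[xe xf xg] nV sup le_fg.
by split; [split; [exact: xe|exact: xg|exact: xf]|exact: nV|exact: sup|
  exact: le_fg].
Qed.

Lemma reached_le {f g} : reached f g -> (Dhier x <= node_value x f g)%E.
Proof.
have [le_node _] := le_Dhier (Dhier x).
by case=> [/le_node|/le_node]; rewrite ?node_valueN; apply.
Qed.

Lemma reached_childl {f g} :
  reached f g -> accepted x f (f + g) -> reached f (f + g).
Proof.
case=> w acc; [left|right].
  by case: w => w; [left|right]; exact: walk_snocl.
rewrite opprD.
have {}acc : accepted x (- f) (- f + - g) by rewrite -opprD; exact: acceptedN.
by case: w => w; [left|right]; exact: walk_snocl.
Qed.

Lemma reached_childr {f g} :
  reached f g -> accepted x (f + g) g -> reached (f + g) g.
Proof.
case=> w acc; [left|right].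
  by case: w => w; [left|right]; exact: walk_snocr.
rewrite opprD.
have {}acc : accepted x (- f + - g) (- g) by rewrite -opprD; exact: acceptedN.
by case: w => w; [left|right]; exact: walk_snocr.
Qed.

Lemma reached_unit {f g} :
  direct_pair f g -> nsq f = 1 -> nsq g = 1 -> reached f g.
Proof.
move=> fg f1 g1; have [v1 v2] := unit_visited.
by case: (unit_direct_pair _ _ f1 g1 fg) => -[-> ->]; rewrite /reached ?opprK;
  [left|left|right|right].
Qed.

Lemma not_accepted {f g} : Vbar x (f + g) -> direct_pair f g ->
  ~ accepted x f g ->
  [/\ [/\ both_in Omega x (f + g), both_in Omega x f & both_in Omega x g],
      ~ V x (f + g) & Delta f x + Delta g x <= Delta (f + g) x].
Proof.
move=> Ve fg nacc.
have nV : ~ V x (f + g) by move=> ?; apply: nacc; left.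
have VO : V_Omega Omega x (f + g) by case: Ve.
split=> //; first exact/(V_OmegaE fg).
by rewrite leNgt; apply/negP => ?; apply: nacc; right.
Qed.

(** The bound on [D_hier] that starts the chain of pruned nodes: the first of
    them has the summands [h] and [f + g], and its parent was visited. *)
Lemma reached_le_mull {f g h} : reached f g ->
  h = f \/ h = g -> 0 <= Delta h x -> 0 <= Delta (f + g) x ->
  (Dhier x <= (Delta h x * Delta (f + g) x)%:E)%E.
Proof.
move=> /reached_le le_node hfg h0 e0; apply: le_trans le_node _.
rewrite lee_fin mulrC -(Delta_pos_id _ _ h0) -(Delta_pos_id _ _ e0).
by case: hfg => ->; [apply: hfun_le12|apply: hfun_le13]; exact: Delta_pos_ge0.
Qed.

(** The product of differences does not decrease: by superadditivity at the
    parent, [Delta g] is replaced by the larger [Delta (f + g)]. *)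
Lemma pruned_childl {f g} : convex_below (nsq (f + (f + g))) ->
  T_vertex f -> nsq f < nsq (f + (f + g)) ->
  pruned f g -> both_in Omega x (f + (f + g)) -> ~ V x (f + (f + g)) ->
  pruned f (f + g).
Proof.
move=> conv Tf ltf [[xe xf xg] _ supe le_fg] xc nVc.
have f0 : 0 < Delta f x by exact: conv Tf ltf gx xf.
have g_le : Delta g x <= Delta (f + g) x.
  by apply: le_trans supe; rewrite lerDr; exact: ltW.
split; [by split|exact: nVc| |].
  apply: (Delta_superadditive_child xf xg xe xc _ supe) => y gy yf.
  by apply: ltW; exact: conv Tf ltf gy yf.
by apply: le_trans le_fg _; rewrite lee_fin (ler_pM2l f0).
Qed.

(** The refusal of a child of a reached node prunes it. Below a pruned node,
    hierarchy keeps vectors out of the stencil, so they can only belong to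
    [V_Omega], where [pruned_childl] applies. *)
Lemma reached_or_pruned {f g} : direct_pair f g -> Vbar x (f + g) ->
  convex_below (nsq (f + g)) -> reached f g \/ pruned f g.
Proof.
apply: (stern_brocot_ind (fun f g => Vbar x (f + g) ->
  convex_below (nsq (f + g)) -> reached f g \/ pruned f g)).
- by move=> p q pq p1 q1 _ _; left; exact: reached_unit.
- move=> p q pq IH Vc conv.
  have pc := direct_pair_childl pq; have [ltp lte] := direct_pair_nsq_lt pc.
  have [Tp Te] := det_T_vertex pc.1.
  have [_ Ve] := Vbar_summands V_family gx pc Vc.
  have [|reach|prun] := IH Ve.
  + by move=> e y Te' lt_e; apply: conv => //; exact: lt_trans lt_e lte.
  + have [acc|/(not_accepted Vc pc)[[xc xp xe] nV sup]] :=
      pselect (accepted x p (p + q)); first by left; exact: reached_childl.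
    right; split; [by split|exact: nV|exact: sup|].
    apply: (reached_le_mull reach (or_introl erefl)); apply: ltW.
      exact: conv Tp ltp gx xp.
    exact: conv Te lte gx xe.
  + right; have nVc : ~ V x (p + (p + q)).
      by move=> /(V_parentl V_family gx pq); case: prun.
    apply: (pruned_childl conv Tp ltp prun _ nVc).
    by case: Vc => // /(V_OmegaE pc)[].
- move=> p q pq IH Vc conv.
  have pc := direct_pair_childr pq; have [lte ltq] := direct_pair_nsq_lt pc.
  have [Te Tq] := det_T_vertex pc.1.
  have [Ve _] := Vbar_summands V_family gx pc Vc.
  have [|reach|prun] := IH Ve.
  + by move=> e y Te' lt_e; apply: conv => //; exact: lt_trans lt_e lte.
  + have [acc|/(not_accepted Vc pc)[[xc xe xq] nV sup]] :=
      pselect (accepted x (p + q) q); first by left; exact: reached_childr.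
    right; split; [by split|exact: nV|exact: sup|rewrite mulrC].
    apply: (reached_le_mull reach (or_intror erefl)); apply: ltW.
      exact: conv Tq ltq gx xq.
    exact: conv Te lte gx xe.
  + right; have nVc : ~ V x (p + q + q).
      by move=> /(V_parentr V_family gx pq); case: prun.
    have cE : p + q + q = q + (q + p) by rewrite addrC [p + q]addrC.
    have xc : both_in Omega x (p + q + q) by case: Vc => // /(V_OmegaE pc)[].
    (* The left hand case with the two summands exchanged. *)
    apply: prunedC; rewrite [p + q]addrC.
    move: conv ltq nVc xc; rewrite cE => conv ltq nVc xc.
    exact: (pruned_childl conv Tq ltq (prunedC prun) xc nVc).
Qed.

(** Superadditivity puts [hfun] in its first case, where it is the product of
    the last two arguments. *)
Lemma pruned_node_value {f g} : convex_below (nsq (f + g)) -> direct_pair f g ->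
  pruned f g -> (Dhier x <= node_value x f g)%E /\ 0 < Delta (f + g) x.
Proof.
move=> conv fg [[xe xf xg] _ sup le_fg].
have [ltf ltg] := direct_pair_nsq_lt fg; have [Tf Tg] := det_T_vertex fg.1.
have f0 : 0 < Delta f x by exact: conv Tf ltf gx xf.
have g0 : 0 < Delta g x by exact: conv Tg ltg gx xg.
have e0 : 0 < Delta (f + g) x by exact: lt_le_trans (addr_gt0 f0 g0) sup.
split; last exact: e0.
have posE h : 0 < Delta h x -> Delta_pos h x = Delta h x.
  by move=> h0; apply/Delta_pos_id/ltW.
rewrite /loop_value /Defs.hDelta (posE _ e0) (posE _ f0) (posE _ g0).
by rewrite (hfun_superadditive _ _ _ sup).
Qed.

Lemma unit_Delta_gt0 {e} :
  (0 < node_value x (1, 0)%R (0, 1)%R)%E -> nsq e = 1 -> 0 < Delta e x.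
Proof.
rewrite lte_fin => /hDelta_gt0[_ d1 d2] /unit_vector[]->.
- exact: d1.
- exact: d2.
- by rewrite -(DeltaN (-1, 0)); exact: d1.
- by rewrite -(DeltaN (0, -1)); exact: d2.
Qed.

Lemma Dhier_gt0_Delta {e} : (0 < Dhier x)%E -> T_vertex e ->
  both_in Omega x e -> convex_below (nsq e) -> 0 < Delta e x.
Proof.
move=> D0 Te xe conv.
have reached_gt0 f g : reached f g -> (0 < node_value x f g)%E.
  by move=> /reached_le; exact: lt_le_trans.
have [e1|[f [g [fg eE]]]] := T_vertexP _ Te.
  apply: unit_Delta_gt0 e1; apply: reached_gt0; left.
  by have [] := unit_visited.
have := both_in_Vbar V_family gx Te xe; rewrite eE in conv * => Ve.
have [/reached_gt0|/(pruned_node_value conv fg)[]//] :=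
  reached_or_pruned fg Ve conv.
by rewrite lte_fin => /hDelta_gt0[].
Qed.

Lemma Dbar_gt0_Delta {e} : (0 < Dbar x)%E -> T_vertex e ->
  both_in Omega x e -> 0 < Delta e x.
Proof.
move=> D0 Te xe.
have [le_node _] := le_Dbar (Dbar x).
have node_gt0 f g : direct_pair f g -> Vbar x (f + g) ->
    (0 < node_value x f g)%E.
  by move=> fg Ve; apply: lt_le_trans D0 _; exact: le_node.
have [e1|[f [g [fg eE]]]] := T_vertexP _ Te.
  apply: unit_Delta_gt0 e1; apply: node_gt0 => //.
  by have [/visited_node[]] := unit_visited.
have := both_in_Vbar V_family gx Te xe; rewrite eE => Ve.
by have := node_gt0 f g fg Ve; rewrite lte_fin => /hDelta_gt0[].
Qed.

Lemma Dhier_eq_Dbar : (forall n, convex_below n) -> Dhier x = Dbar x.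
Proof.
move=> conv; apply/le_anti/andP; split.
  apply/le_Dbar => f g fg Ve.
  have [/reached_le//|/(pruned_node_value (conv _) fg)[]//] :=
    reached_or_pruned fg Ve (conv _).
apply/le_Dhier => f g /visited_node[fg Ve].
by have [+ _] := le_Dbar (Dbar x); apply.
Qed.

End AtPoint.

End Comparison.

Theorem theorem1p19 (R : realType) (Omega : set (plane R))
  (Omega_convex : convex_set Omega) (Omega_open : open Omega)
  (Omega_bounded : bounded_set Omega)
  (V : Z2 -> set Z2) (V_family : stencil_family Omega V)
  (u : plane R -> R) :
  (forall x, grid Omega x -> (0 < D_hier Omega u V x)%E) \/
  (forall x, grid Omega x -> (0 < D_op Omega u (stencil_bar Omega V) x)%E) ->
  forall x, grid Omega x ->
    D_hier Omega u V x = D_op Omega u (stencil_bar Omega V) x.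
Proof.
move=> D_gt0 x gx.
apply: (Dhier_eq_Dbar V_family Omega_bounded gx).
case: D_gt0 => D_gt0 n; last first.
  move=> e y Te _ gy ye.
  exact: (Dbar_gt0_Delta V_family Omega_bounded gy (D_gt0 y gy)).
have :  forall k : nat, convex_below (R := R) (Omega := Omega) (u := u) k%:Z.
  elim=> [e y _ |k IH e y Te le_e gy ye]; first by have := nsq_ge0 e; lia.
  apply: (Dhier_gt0_Delta V_family Omega_bounded gy (D_gt0 y gy)) => //.
  move=> e' z Te' lt_e'.
  by apply: IH => //; lia.
move=> conv e y Te lt_e; apply: (conv (absz (nsq e)).+1) => //.
by have := nsq_ge0 e; lia.
Qed.
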